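(* Let $G$ be a faithful weakly hyperbolic group that is not lim-free. Then $G$ contains infinite direct sums of infinite non-abelian subgroups; that is, there is an infinite family of infinite non-abelian subgroups of $G$ that generate their direct sum in $G$.
   Context: A hyperbolic space is a geodesic metric space $S$ (not assumed proper) such that for some $\delta\ge 0$, $\langle x|y\rangle_o\ge\min\{\langle x|z\rangle_o,\langle z|y\rangle_o\}-\delta$ for all $x,y,z,o\in S$, where $\langle x|y\rangle_o=\frac12(d(x,o)+d(y,o)-d(x,y))$. Its Gromov boundary $\partial S$ is the set of equivalence classes of sequences $(x_i)$ in $S$ with $\langle x_i|x_j\rangle_o\to\infty$ as $i,j\to\infty$, where $(x_i)\sim(y_i)$ iff $\langle x_i|y_j\rangle_o\to\infty$; a sequence in the class $a$ is said to converge to $a$. For $a,b\in\partial S$, $\langle a|b\rangle_o$ is the infimum of $\liminf_{i,j}\langle x_i|y_j\rangle_o$ over sequences $x_i\to a$, $y_j\to b$; $\partial S$ is topologized so that the sets $\{b\in\partial S:\langle a|b\rangle_o>r\}$, $r\ge 0$, form a neighborhood base at $a$. All group actions on hyperbolic spaces are by isometries; they extend to actions by homeomorphisms on $\partial S$. The limit set $\Lambda_S(G)\subseteq\partial S$ of a group $G$ acting on $S$ is the set of points of $\partial S$ that are limits of sequences in an orbit $Gs$ (independent of $s\in S$), with the subspace topology. An element $g\in G$ is loxodromic if $\langle g\rangle$ has unbounded orbits in $S$ and fixes exactly two points of $\partial S$. The action of $G$ on $S$ is of general type if its orbits are unbounded and $G$ contains two loxodromic elements with disjoint fixed point sets in $\partial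 S$. An action by homeomorphisms on a topological space $X$ is topologically free if for every nontrivial element $g$ the set of fixed points of $g$ in $X$ has empty interior. A group is faithful weakly hyperbolic if it admits a general type action on a hyperbolic space such that the induced action on the limit set is faithful. It is lim-free if it admits a general type action on a hyperbolic space such that the induced action on the limit set is topologically free. *)

(* Defs.v *)
From HB Require Import structures.
From mathcomp Require Import all_boot all_order all_algebra.
From mathcomp Require Import all_classical all_reals.
From mathcomp Require Import ereal topology normedtype.
From mathcomp Require Import lra.

Set Implicit Arguments.
Unset Strict Implicit.
Unset Printing Implicit Defensive.
Import Order.TTheory GRing.Theory Num.Theory.
Import numFieldNormedType.Exports.
Local Open Scope classical_set_scope.
Local Open Scope ring_scope.

Section MetricSpaces.
Context {R : realType} {S : metricType R}.
Implicit Types (x y z o : S) (u v : nat -> S).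

Definition geodesic_space : Prop := forall x y, exists c : R -> S,
  [/\ c 0 = x, c (mdist x y) = y &
      forall s t, 0 <= s <= mdist x y -> 0 <= t <= mdist x y ->
        mdist (c s) (c t) = `|s - t| ].

Definition gromov_prod o x y : R := (mdist x o + mdist y o - mdist x y) / 2.

Definition gromov_hyperbolic : Prop := exists2 delta : R, 0 <= delta &
  forall x y z o, Num.min (gromov_prod o x z) (gromov_prod o z y) - delta
                  <= gromov_prod o x y.

(* Changing o changes Gromov products by a bounded amount, so quantifying over
   every basepoint amounts to using any single one. *)
Definition gromov_equiv u v : Prop := forall o,
  gromov_prod o (u p.1) (v p.2) @[p --> filter_prod \oo \oo] --> +oo.

Definition gromov_seq u : Prop := gromov_equiv u u.

Definition bounded_subset (A : set S) : Prop :=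
  exists M : R, forall x y, A x -> A y -> mdist x y <= M.

Lemma gromov_prodC o x y : gromov_prod o x y = gromov_prod o y x.
Proof. by rewrite /gromov_prod (metric_sym x y) [in LHS](addrC (mdist x o)). Qed.

Lemma gromov_prod_base o o' x y :
  gromov_prod o' x y <= gromov_prod o x y + mdist o o'.
Proof.
rewrite /gromov_prod.
by have := metric_triangle x o o'; have := metric_triangle y o o'; lra.
Qed.

End MetricSpaces.

Arguments geodesic_space {R} S.
Arguments gromov_hyperbolic {R} S.

HB.mixin Record Metric_isHyperbolic (R : realType) S & Metric R S := {
  geodesicP : geodesic_space S;
  gromov_hyperbolicP : gromov_hyperbolic S
}.

#[short(type="hyperbolicType")]
HB.structure Definition Hyperbolic (R : realType) :=
  {S of Metric R S & Metric_isHyperbolic R S}.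

(* A boundary point is literally an equivalence class of sequences; u converges
   to a when u belongs to the class a. *)
Record boundary (R : realType) (S : hyperbolicType R) := Boundary {
  boundary_class : set (nat -> S);
  boundary_classP : exists2 u, gromov_seq u &
    boundary_class = [set v | gromov_seq v /\ gromov_equiv u v]
}.

HB.instance Definition _ (R : realType) (S : hyperbolicType R) :=
  gen_eqMixin (boundary S).
HB.instance Definition _ (R : realType) (S : hyperbolicType R) :=
  gen_choiceMixin (boundary S).

Section BoundaryTopology.
Context {R : realType} {S : hyperbolicType R}.
Implicit Types (x y z o : S) (u v : nat -> S) (a b c : boundary S).

Definition boundary_prod o a b : \bar R :=
  ereal_inf [set limf_einf (fun p => (gromov_prod o (w.1 p.1) (w.2 p.2))%:E)
                           (filter_prod \oo \oo)
            | w in boundary_class a `*` boundary_class b].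

Definition boundary_ball o a (r : R) : set (boundary S) :=
  [set b | (r%:E < boundary_prod o a b)%E].

Definition boundary_nbhs a : set_system (boundary S) :=
  [set U | forall o, exists2 r : R, 0 <= r & boundary_ball o a r `<=` U].

Lemma boundary_inj a b : boundary_class a = boundary_class b -> a = b.
Proof.
case: a b => [A HA] [B HB] /= AB; case: _ / AB in HB *.
by rewrite (Prop_irrelevance HA HB).
Qed.

Lemma boundary_neq0 a : exists u, boundary_class a u.
Proof. by case: (boundary_classP a) => u uS ->; exists u. Qed.

Lemma boundary_class_equiv a u v : boundary_class a u -> boundary_class a v -> gromov_equiv u v.
Proof.
case: (boundary_classP a) => w _ -> [_ wu] [_ wv] o.
case: (@gromov_hyperbolicP R S) => d d0 hyp.
apply/cvgryPge => A.
have [[P Q] /= [PN QN] PQ] := (cvgryPge _).1 (wu o) (A + d).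
have [[P' Q'] /= [PN' QN'] PQ'] := (cvgryPge _).1 (wv o) (A + d).
have [n [Pn P'n]] := filter_ex (filterI PN PN').
exists (Q, Q') => //= -[i j] /= [Qi Qj].
have /= h1 := PQ (n, i) (conj Pn Qi); have /= h2 := PQ' (n, j) (conj P'n Qj).
apply: le_trans (hyp (u i) (v j) (w n) o).
by rewrite lerBrDr le_min h2 andbT gromov_prodC.
Qed.

Lemma boundary_prod_gt o a b (r : R) u v :
  (r%:E < boundary_prod o a b)%E ->
  boundary_class a u -> boundary_class b v ->
  \forall p \near filter_prod \oo \oo, r < gromov_prod o (u p.1) (v p.2).
Proof.
move=> rab au bv.
have : (r%:E < limf_einf (fun p => (gromov_prod o (u p.1) (v p.2))%:E)
                         (filter_prod \oo \oo))%E.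
  by apply: lt_le_trans rab _; apply: ereal_inf_lbound; exists (u, v).
rewrite limf_einfE => /ereal_sup_gt [_ [V FV <-]] rV.
apply: filterS FV => p Vp; rewrite -lte_fin.
by apply: lt_le_trans rV _; apply: ereal_inf_lbound; exists p.
Qed.

Lemma boundary_prod_ge o a b (r : R) :
  (forall u v, boundary_class a u -> boundary_class b v ->
    \forall p \near filter_prod \oo \oo, r <= gromov_prod o (u p.1) (v p.2)) ->
  (r%:E <= boundary_prod o a b)%E.
Proof.
move=> H; apply: le_ereal_inf_tmp => _ [[u v] [/= au bv] <-].
rewrite limf_einfE; apply: le_ereal_sup_tmp.
exists (ereal_inf ((fun p => (gromov_prod o (u p.1) (v p.2))%:E) @`
   [set p | r <= gromov_prod o (u p.1) (v p.2)])).
  by exists [set p | r <= gromov_prod o (u p.1) (v p.2)] => //; exact: H.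
by apply: le_ereal_inf_tmp => _ [p /= rp <-]; rewrite lee_fin.
Qed.

Lemma boundary_ball_center o a r : boundary_ball o a r a.
Proof.
rewrite /boundary_ball /=.
apply: (@lt_le_trans _ _ (r + 1)%:E); first by rewrite lte_fin ltrDl.
apply: boundary_prod_ge => u v au av.
exact: (cvgryPge _).1 (boundary_class_equiv au av o) _.
Qed.

Lemma boundary_ball_trans : exists2 k : R, 0 <= k &
  forall o a b c (r : R), boundary_ball o a (r + k) b ->
    boundary_ball o b (r + k) c -> boundary_ball o a r c.
Proof.
case: (@gromov_hyperbolicP R S) => d d0 hyp.
exists (d + 1) => [|o a b c r ab bc]; first by rewrite addr_ge0.
apply: (@lt_le_trans _ _ (r + 1)%:E); first by rewrite lte_fin ltrDl.
apply: boundary_prod_ge => u w au cw; have [v bv] := boundary_neq0 b.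
have [[P Q] /= [PN QN] PQ] := boundary_prod_gt ab au bv.
have [[P' Q'] /= [PN' QN'] PQ'] := boundary_prod_gt bc bv cw.
have [n [Qn P'n]] := filter_ex (filterI QN PN').
exists (P, Q') => //= -[i j] /= [Pi Qj].
have /= /ltW h1 := PQ (i, n) (conj Pi Qn).
have /= /ltW h2 := PQ' (n, j) (conj P'n Qj).
apply: le_trans (hyp (u i) (w j) (v n) o).
by rewrite lerBrDr le_min -addrA (addrC 1) h1 h2.
Qed.

Lemma boundary_ball_base o o' a (r : R) :
  boundary_ball o' a (r + mdist o o' + 1) `<=` boundary_ball o a r.
Proof.
move=> b ab.
apply: (@lt_le_trans _ _ (r + 1)%:E); first by rewrite lte_fin ltrDl.
apply: boundary_prod_ge => u v au bv.
apply: filterS (boundary_prod_gt ab au bv) => p /=.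
by have := gromov_prod_base o o' (u p.1) (v p.2); lra.
Qed.

Lemma boundary_nbhs_filter a : ProperFilter (boundary_nbhs a).
Proof.
split.
  have [u _] := boundary_neq0 a.
  by move=> /(_ (u 0%N)) [r _ /(_ a)]; apply; exact: boundary_ball_center.
split=> [o|U V UN VN o|U V UV UN o]; first by exists 0.
  have [r r0 rU] := UN o; have [s s0 sV] := VN o.
  exists (Num.max r s) => [|b ab]; first by rewrite le_max r0.
  by split; [apply: rU|apply: sV]; apply: le_lt_trans ab;
    rewrite lee_fin le_max lexx ?orbT.
by have [r r0 rU] := UN o; exists r => //; exact: subset_trans UV.
Qed.

Lemma boundary_nbhs_singleton a U : boundary_nbhs a U -> U a.
Proof.
have [u _] := boundary_neq0 a.
by move=> /(_ (u 0%N)) [r _]; apply; exact: boundary_ball_center.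
Qed.

Lemma boundary_nbhs_nbhs a U :
  boundary_nbhs a U -> boundary_nbhs a (boundary_nbhs^~ U).
Proof.
move=> UN o; have [r r0 rU] := UN o; have [k k0 ktr] := boundary_ball_trans.
exists (r + k) => [|b ab o']; first by rewrite addr_ge0.
exists (r + k + mdist o o' + 1).
  by rewrite !addr_ge0 // mdist_ge0.
by move=> c bc; apply: rU; apply: ktr ab _; exact: boundary_ball_base bc.
Qed.

End BoundaryTopology.

HB.instance Definition _ (R : realType) (S : hyperbolicType R) :=
  hasNbhs.Build (boundary S) boundary_nbhs.
HB.instance Definition _ (R : realType) (S : hyperbolicType R) :=
  Nbhs_isNbhsTopological.Build (boundary S)
    boundary_nbhs_filter boundary_nbhs_singleton boundary_nbhs_nbhs.

Lemma nbhs_boundaryE (R : realType) (S : hyperbolicType R) (o : S)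
    (a : boundary S) :
  nbhs a = filter_from [set r : R | 0 <= r] (boundary_ball o a).
Proof.
apply/seteqP; split=> U; first exact: (fun UN : boundary_nbhs a U => UN o).
move=> [r /= r0 rU]; change (boundary_nbhs a U) => o'.
exists (r + mdist o o' + 1).
  by rewrite !addr_ge0 // mdist_ge0.
by apply: subset_trans rU; exact: boundary_ball_base.
Qed.

Local Open Scope group_scope.

Record isometric_action (G : groupType) (R : realType) (S : metricType R) :=
  IsometricAction {
    iact :> G -> S -> S;
    iact1 : forall x, iact 1 x = x;
    iactM : forall g h x, iact (g * h) x = iact g (iact h x);
    iact_isom : forall g x y, mdist (iact g x) (iact g y) = mdist x y
  }.

Section InducedActions.
Context {G : groupType} {R : realType} {S : hyperbolicType R}.
Variable rho : isometric_action G S.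
Implicit Types (g h : G) (s : S) (u v : nat -> S) (a b : boundary S).

Lemma iactK g : cancel (rho g) (rho g^-1).
Proof. by move=> x; rewrite -iactM mulVg iact1. Qed.

Lemma iactVK g : cancel (rho g^-1) (rho g).
Proof. by move=> x; rewrite -iactM mulgV iact1. Qed.

Lemma gromov_prod_act g o x y :
  gromov_prod (rho g o) (rho g x) (rho g y) = gromov_prod o x y.
Proof. by rewrite /gromov_prod !iact_isom. Qed.

Lemma gromov_equiv_act g u v :
  gromov_equiv u v -> gromov_equiv (rho g \o u) (rho g \o v).
Proof.
move=> uv o; rewrite -(iactVK g o); apply: cvg_trans (uv (rho g^-1 o)).
by apply: near_eq_cvg; apply: nearW => p /=; rewrite gromov_prod_act.
Qed.

Lemma boundary_act_subproof g a : exists2 u, gromov_seq u &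
  [set rho g \o v | v in boundary_class a] = [set v | gromov_seq v /\ gromov_equiv u v].
Proof.
case: (boundary_classP a) => u uS ->; exists (rho g \o u).
  exact: gromov_equiv_act.
apply/seteqP; split=> [_ [v [vS uv] <-]|v [vS uv]].
  by split; exact: gromov_equiv_act.
have Kc (w : nat -> S) : rho g^-1 \o (rho g \o w) = w by apply/funext => n; exact: iactK.
exists (rho g^-1 \o v); last by apply/funext => n; exact: iactVK.
by split; [|rewrite -(Kc u)]; exact: gromov_equiv_act.
Qed.

Definition boundary_act g a : boundary S := Boundary (boundary_act_subproof g a).

Definition limit_set : set (boundary S) :=
  [set a | exists s (h : nat -> G), boundary_class a (fun n => rho (h n) s)].

Lemma limit_set_act g a : a \in limit_set -> boundary_act g a \in limit_set.
Proof.
move=> /set_mem [s [h ah]]; apply/mem_set; exists s, (fun n => g * h n).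
by exists (fun n => rho (h n) s) => //; apply/funext => n /=; rewrite iactM.
Qed.

Definition limit_set_action g (a : limit_set) : limit_set :=
  exist _ (boundary_act g (val a)) (limit_set_act g (valP a)).

Definition cyclic_subgroup g : set G :=
  [set h | exists n : nat, h = g ^+ n \/ h = g ^- n].

Definition unbounded_orbits (H : set G) : Prop :=
  forall s, ~ bounded_subset [set rho h s | h in H].

Definition boundary_fix g : set (boundary S) := [set a | boundary_act g a = a].

Definition loxodromic g : Prop :=
  unbounded_orbits (cyclic_subgroup g) /\
  exists a b, a != b /\ boundary_fix g = [set a; b].

Definition general_type : Prop :=
  unbounded_orbits setT /\
  exists g h, [/\ loxodromic g, loxodromic h &
                  boundary_fix g `&` boundary_fix h = set0].

End InducedActions.

Arguments limit_set_action {G R S} rho g a.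

Definition faithful_action (G : groupType) (X : Type) (act : G -> X -> X) :
    Prop :=
  forall g : G, (forall x, act g x = x) -> g = 1.

Definition topologically_free (G : groupType) (X : topologicalType)
    (act : G -> X -> X) : Prop :=
  forall g : G, g != 1 -> [set x | act g x = x]^° = set0.

Definition faithful_weakly_hyperbolic (R : realType) (G : groupType) : Prop :=
  exists (S : hyperbolicType R) (rho : isometric_action G S),
    general_type rho /\ faithful_action (limit_set_action rho).

Definition lim_free (R : realType) (G : groupType) : Prop :=
  exists (S : hyperbolicType R) (rho : isometric_action G S),
    general_type rho /\ topologically_free (limit_set_action rho).

Section Subgroups.
Context {G : groupType}.
Implicit Types (A H : set G).

Definition is_subgroup H : Prop := group_closed [in H].

Definition abelian_set A : Prop := forall x y, A x -> A y -> commute x y.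

Definition generated_subgroup A : set G := smallest is_subgroup A.

(* Internal (restricted) direct sum: distinct summands centralise each other
   and each summand meets the subgroup generated by the others trivially. *)
Definition generate_direct_sum (I : Type) (H : I -> set G) : Prop :=
  (forall i j x y, i <> j -> H i x -> H j y -> commute x y) /\
  (forall i,
     H i `&` generated_subgroup (\bigcup_(j in [set j | j <> i]) H j) = [set 1]).

End Subgroups.

(* Main.v *)
(* Fix g <> 1 acting trivially on an open piece U of the limit set, and let A be
   the complement of U.  Some small W satisfies g W `&` W = set0, hence
   W `<=` A, and a general type action is proximal enough to provide k with
   k A `<=` W.  The sets k^i g k A are then pairwise disjoint, so their rigid
   stabilisers commute and generate their direct sum by faithfulness.  Each is
   conjugate to that of A, which contains the distinct conjugates of g by powers
   of k, and in which g does not commute with k g k^-1, because g moves the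
   support of the latter, inside W, off W.

   To find k, write h fixing two distinct boundary points a, b: <a|b> is the
   same from o and from h o, so hyperbolicity puts h o near a or b once it is far
   from o.  Hence for powers P, Q with large displacement of two independent
   loxodromics no point is near both an orbit point P^(+-1) o and an orbit point
   Q^(+-1) o, so for all x, y some f among 1, P, Q makes <f x|y> bounded.
   Given g_n o -> a and h_n o -> c, choosing f for x = g_n^-1 o and y = h_n^-1 o
   and putting k = h_n f g_n^-1 makes k o near c and k^-1 o near a; then k sends
   every boundary point not near a to one near c. *)
Require Import Defs.
From mathcomp Require Import all_boot all_order all_algebra.
From mathcomp Require Import all_classical all_reals.
From mathcomp Require Import ereal topology normedtype.
From mathcomp Require Import lra.

Set Implicit Arguments.
Unset Strict Implicit.
Unset Printing Implicit Defensive.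
Import Order.TTheory GRing.Theory Num.Theory.
Import numFieldNormedType.Exports.
Local Open Scope classical_set_scope.
Local Open Scope ring_scope.
Local Open Scope group_scope.

Lemma is_subgroupP (G : groupType) (H : set G) : H 1 ->
  (forall x y, H x -> H y -> H (x * y^-1)) -> is_subgroup H.
Proof.
move=> H1 HB; split; first exact: mem_set.
by move=> x y /set_mem Hx /set_mem Hy; apply/mem_set; exact: HB.
Qed.

(** * Rigid stabilisers *)

Section RigidStabilizers.
Context {G : groupType} {X : Type}.
Variable act : G -> X -> X.
Hypothesis act1 : forall x, act 1 x = x.
Hypothesis actM : forall g h x, act (g * h) x = act g (act h x).
Hypothesis act_faithful : faithful_action act.

Let actK g : cancel (act g) (act g^-1).
Proof. by move=> x; rewrite -actM mulVg act1. Qed.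

Let actVK g : cancel (act g^-1) (act g).
Proof. by move=> x; rewrite -actM mulgV act1. Qed.

Definition rigid_stabilizer (B : set X) : set G :=
  [set g | forall x, ~ B x -> act g x = x].

Definition pointwise_stabilizer (B : set X) : set G :=
  [set g | forall x, B x -> act g x = x].

Lemma faithful_action_inj g h : (forall x, act g x = act h x) -> g = h.
Proof.
move=> gh; apply: (mulIg h^-1); rewrite mulgV; apply: act_faithful => x.
by rewrite actM gh actVK.
Qed.

Lemma pointwise_stabilizer_subgroup B : is_subgroup (pointwise_stabilizer B).
Proof.
apply: is_subgroupP => [x _|g h gB hB x Bx]; first exact: act1.
by rewrite actM -{1}(hB _ Bx) actK gB.
Qed.

Lemma rigid_stabilizerE B : rigid_stabilizer B = pointwise_stabilizer (~` B).
Proof. by []. Qed.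

Lemma rigid_stabilizer_subgroup B : is_subgroup (rigid_stabilizer B).
Proof. by rewrite rigid_stabilizerE; exact: pointwise_stabilizer_subgroup. Qed.

Lemma rigid_stabilizer_sub B C : B `<=` C ->
  rigid_stabilizer B `<=` rigid_stabilizer C.
Proof. by move=> BC g gB x Cx; apply: gB => /BC. Qed.

Lemma rigid_stabilizer_act B g x : rigid_stabilizer B g -> B x -> B (act g x).
Proof.
move=> gB Bx; apply: contrapT => /[dup] nB /gB /(can_inj (actK g)) gx.
by apply: nB; rewrite gx.
Qed.

(** The preimage of B under [act t^-1] is the translate t B, in a form whose membership unfolds
    without an existential. *)
Lemma rigid_stabilizer_conj B g t : rigid_stabilizer B g ->
  rigid_stabilizer (act t^-1 @^-1` B) (t * g * t^-1).
Proof. by move=> gB x /= nB; rewrite !actM gB // actVK. Qed.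

Lemma rigid_stabilizer_disjoint_pointwise B C : B `&` C = set0 ->
  rigid_stabilizer C `<=` pointwise_stabilizer B.
Proof.
move=> BC0 g gC x Bx; apply: gC => Cx.
by have : (B `&` C) x by []; rewrite BC0.
Qed.

Lemma rigid_pointwise_stabilizer_trivial B g :
  rigid_stabilizer B g -> pointwise_stabilizer B g -> g = 1.
Proof.
move=> gB gC; apply: act_faithful => x.
by have [/gC|/gB] := pselect (B x).
Qed.

Lemma rigid_stabilizer_disjoint_commute B C g h : B `&` C = set0 ->
  rigid_stabilizer B g -> rigid_stabilizer C h -> commute g h.
Proof.
move=> BC0 gB hC; apply: faithful_action_inj => x; rewrite !actM.
have hB := rigid_stabilizer_disjoint_pointwise BC0 hC.
have gC : pointwise_stabilizer C g.
  by apply: (@rigid_stabilizer_disjoint_pointwise C B) gB; rewrite setIC.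
have [Bx|nBx] := pselect (B x).
  by rewrite (hB x) // hB //; exact: rigid_stabilizer_act.
have [Cx|nCx] := pselect (C x).
  by rewrite (gC x) // gC //; exact: rigid_stabilizer_act.
by rewrite hC // gB // hC.
Qed.

(** The pointwise stabiliser of [B i] is a subgroup containing every other summand, hence what they
    generate. By faithfulness it meets the rigid stabiliser of [B i] trivially. *)
Lemma rigid_stabilizers_direct_sum (I : Type) (B : I -> set X) :
  (forall i j, i <> j -> B i `&` B j = set0) ->
  generate_direct_sum (fun i => rigid_stabilizer (B i)).
Proof.
move=> B0; split=> [i j g h ij gB hB|i].
  exact: rigid_stabilizer_disjoint_commute (B0 i j ij) gB hB.
apply/seteqP; split=> [g [gB gS]|_ ->]; last first.
  split; first by move=> x _; exact: act1.
  by move=> K [[/set_mem K1 _] _].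
apply: rigid_pointwise_stabilizer_trivial gB _; apply: gS; split.
  exact: pointwise_stabilizer_subgroup.
move=> h [j /= ji hB]; apply: rigid_stabilizer_disjoint_pointwise hB.
by apply: B0 => /esym.
Qed.

(** * Translates of a set contracted into a displaced subset *)

Section Contraction.
Variables (A W : set X) (g k : G).
Hypothesis g_neq1 : g <> 1.
Hypothesis gA : rigid_stabilizer A g.
Hypothesis gW : forall x, W x -> ~ W (act g x).
Hypothesis kAW : forall x, A x -> W (act k x).

(** A point of W outside A would be fixed by g and so stay in W, against [gW]. *)
Let WA x : W x -> A x.
Proof. by move=> Wx; apply: contrapT => /gA gx; apply: (gW Wx); rewrite gx. Qed.

Let A_gact x : A x -> A (act g x).
Proof. exact: rigid_stabilizer_act gA. Qed.

Let W_kexp n x : A x -> W (act (k ^+ n.+1) x).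
Proof.
elim: n x => [|n IHn] x Ax; first by rewrite expg1; exact: kAW.
by rewrite expgSr actM; apply/IHn/WA/kAW.
Qed.

(** The factor g k sends A into A but off W, whereas every positive power of k sends A into W. This
    separates the translates of A by different [t i]. *)
Let t (i : nat) := k ^+ i * (g * k).

Let kexpI m n x y : (m < n)%N -> A y -> act (k ^+ m) x = act (k ^+ n) y -> W x.
Proof.
move=> mn Ay; rewrite -(subnKC mn) addSnnS expgnDr actM => /(can_inj (actK _)) ->.
exact: W_kexp.
Qed.

Lemma contraction_disjoint i j : i <> j ->
  (act (t i)^-1 @^-1` A) `&` (act (t j)^-1 @^-1` A) = set0.
Proof.
wlog ij : i j / (i < j)%N.
  move=> H /[dup] + /eqP; rewrite neq_ltn => + /orP[ij|ij]; first exact: H.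
  by rewrite setIC => /nesym; exact: H.
move=> _; rewrite -subset0 => x [/= Ai Aj].
have : act (t i) (act (t i)^-1 x) = act (t j) (act (t j)^-1 x).
  by rewrite !actVK.
(* Only the outer [t] are unfolded: this gives y, z in A with k^i g k y = k^j g k z, and cancelling
   k^i puts g k y in W although k y is in W. *)
rewrite {1 3}/t !actM; move: (act _ x) (act _ x) Ai Aj => y z Ay Az.
move=> /(kexpI ij) h; apply: (gW (kAW Ay)); apply: h.
exact/A_gact/WA/kAW.
Qed.

(** If y is not in W, then k^m y is outside k^n A, so the second conjugate fixes it. Equality would
    make g fix every point off W; since one of x and g x is always off W, g would be trivial. *)
Let conj_kexp_neq m n : (m < n)%N ->
  k ^+ m * g * (k ^+ m)^-1 <> k ^+ n * g * (k ^+ n)^-1.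
Proof.
move=> mn mnE; apply: g_neq1; apply: act_faithful => x.
have [Ax|/gA //] := pselect (A x).
apply: contrapT => gx.
have nW : ~ W x \/ ~ W (act g x).
  by have [/gW|] := pselect (W x); [right|left].
have kN y : ~ W y ->
    act (k ^+ n * g * (k ^+ n)^-1) (act (k ^+ m) y) = act (k ^+ m) y.
  move=> nWy; apply: (rigid_stabilizer_conj gA) => /= Ay; apply: nWy.
  by apply: (kexpI mn Ay); rewrite actVK.
have := kN; rewrite -mnE => km.
have {}km y : ~ W y -> act g y = y.
  by move=> /km; rewrite !actM actK => /(can_inj (actK _)).
case: nW => /km // /(can_inj (actK _)) //.
Qed.

Lemma contraction_infinite i :
  infinite_set (rigid_stabilizer (act (t i)^-1 @^-1` A)).
Proof.
(* The conjugates of g by powers of k are supported in A, because each k^n A lies in A; conjugating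
   by [t i] moves them to the i-th translate. *)
pose f n := t i * (k ^+ n * g * (k ^+ n)^-1) * (t i)^-1.
have finj : injective f.
  move=> m n /mulIg /mulgI mn; apply/eqP; rewrite -[_ == _]negbK neq_ltn.
  by apply/negP => /orP[/conj_kexp_neq|/conj_kexp_neq]; apply.
have fr n : rigid_stabilizer (act (t i)^-1 @^-1` A) (f n).
  apply/rigid_stabilizer_conj.
  apply: rigid_stabilizer_sub (rigid_stabilizer_conj gA).
  move=> x /= Ax; rewrite -(actVK (k ^+ n) x).
  by case: n Ax => [|n]; [rewrite !expg0 act1|move=> /W_kexp/WA].
move=> /(finite_preimage (in2W finj)) /sub_finite_set fin.
by apply: infinite_nat; apply: fin => n _; exact: fr.
Qed.

(** Suppose g and k g k^-1 commute. For x in k A, the point g x is off W, so k g k^-1 fixes g x, and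
    commuting makes it fix x as well. Being supported in k A, it would be trivial. *)
Lemma contraction_nonabelian i :
  ~ abelian_set (rigid_stabilizer (act (t i)^-1 @^-1` A)).
Proof.
move=> ab; have gk : rigid_stabilizer (act k^-1 @^-1` A) (k * g * k^-1).
  exact: rigid_stabilizer_conj.
have kW x : A (act k^-1 x) -> W x by move/kAW; rewrite actVK.
have : commute (t i * g * (t i)^-1) (t i * (k * g * k^-1) * (t i)^-1).
  apply: ab; apply: rigid_stabilizer_conj => //.
  by apply: rigid_stabilizer_sub gk => x /kW/WA.
move: (t i) => s; rewrite /commute !mulgA !mulgVK => /mulIg.
rewrite -!(mulgA s) => /mulgI ggk.
suff k1 : k * g * k^-1 = 1.
  by apply: g_neq1; apply: (mulgI k); apply: (mulIg k^-1);
    rewrite k1 mulg1 mulgV.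
apply: (rigid_pointwise_stabilizer_trivial gk) => x /kW /gW nW.
apply: (can_inj (actK g)); rewrite -[RHS](gk (act g x)) => [|/kW //].
by rewrite -!actM !mulgA ggk.
Qed.

Lemma contraction_direct_sum : exists (I : Type) (H : I -> set G),
  [/\ infinite_set [set: I],
      forall i, [/\ is_subgroup (H i), infinite_set (H i) & ~ abelian_set (H i)]
    & generate_direct_sum H].
Proof.
exists nat, (fun i => rigid_stabilizer (act (t i)^-1 @^-1` A)); split.
- exact: infinite_nat.
- move=> i; split; first exact: rigid_stabilizer_subgroup.
    exact: contraction_infinite.
  exact: contraction_nonabelian.
- by apply: rigid_stabilizers_direct_sum => i j; exact: contraction_disjoint.
Qed.

End Contraction.
End RigidStabilizers.

Local Open Scope ring_scope.

Lemma near_nat2P (P : nat * nat -> Prop) :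
  (\forall p \near filter_prod \oo \oo, P p) <->
  exists N, forall i j, (N <= i)%N -> (N <= j)%N -> P (i, j).
Proof.
split=> [[[A B] /= [[M _ MA] [N _ NB]] ABP]|[N NP]].
  exists (maxn M N) => i j; rewrite !geq_max => /andP[Mi _] /andP[_ Nj].
  by apply: ABP; split; [exact: MA|exact: NB].
exists ([set n | (N <= n)%N], [set n | (N <= n)%N]); first by split; exists N.
by move=> [i j] /= [Ni Nj]; exact: NP.
Qed.

(** * Gromov products and boundary points *)

Section GromovProducts.
Context {R : realType} {S : metricType R}.
Implicit Types (x y z o : S).

Lemma gromov_prodxx o x : gromov_prod o x x = mdist x o.
Proof. by rewrite /gromov_prod mdistxx; lra. Qed.

Lemma gromov_prod_le_mdist o x y : gromov_prod o x y <= mdist x o.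
Proof.
rewrite /gromov_prod; have := metric_triangle y x o.
by rewrite (metric_sym y x); lra.
Qed.

(** Trades a small product seen from one end of a segment for a large product seen from the other
    end. *)
Lemma gromov_prodD x y z :
  gromov_prod x y z + gromov_prod y x z = mdist x y.
Proof.
rewrite /gromov_prod (metric_sym y x) (metric_sym z y) (metric_sym z x).
by lra.
Qed.

Lemma gromov_prod_lip o x x' y :
  gromov_prod o x y - mdist x x' <= gromov_prod o x' y.
Proof.
rewrite /gromov_prod; have := metric_triangle x x' o.
by have := metric_triangle x' x y; rewrite (metric_sym x' x); lra.
Qed.

End GromovProducts.

Section Boundary.
Context {R : realType} {S : hyperbolicType R}.
Implicit Types (x y z o : S) (u v w : nat -> S) (a b c : boundary S).

(** The minimum is split into two linear hypotheses suited to [lra]; each use costs one d. *)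
Lemma hyperbolicity : exists2 d : R, 0 < d & forall (x y z o : S) (t : R),
  t + d <= gromov_prod o x z -> t + d <= gromov_prod o z y ->
  t <= gromov_prod o x y.
Proof.
case: (@gromov_hyperbolicP R S) => d d0 hyp.
exists (d + 1) => [|x y z o t xz zy]; first by lra.
apply: le_trans (hyp x y z o); rewrite lerBrDr le_min.
by apply/andP; split; lra.
Qed.

Lemma gromov_equivP u v : gromov_equiv u v <->
  forall o (A : R), exists N, forall i j, (N <= i)%N -> (N <= j)%N ->
    A <= gromov_prod o (u i) (v j).
Proof.
split=> [uv o A|uv o].
  apply/(near_nat2P (fun p => A <= gromov_prod o (u p.1) (v p.2))).
  exact: (cvgryPge _).1 (uv o) A.
by apply/cvgryPge => A; apply/near_nat2P; exact: uv.
Qed.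

Lemma gromov_equiv_sym u v : gromov_equiv u v -> gromov_equiv v u.
Proof.
move=> /gromov_equivP uv; apply/gromov_equivP => o A.
have [N NA] := uv o A; exists N => i j Ni Nj.
by rewrite gromov_prodC; exact: NA.
Qed.

Lemma gromov_equiv_trans u v w :
  gromov_equiv u v -> gromov_equiv v w -> gromov_equiv u w.
Proof.
move=> /gromov_equivP uv /gromov_equivP vw; apply/gromov_equivP => o A.
have [d d0 hyp] := hyperbolicity.
have [N NA] := uv o (A + d); have [N' NA'] := vw o (A + d).
exists (maxn N N') => i j; rewrite !geq_max => /andP[Ni _] /andP[_ Nj].
apply: (hyp _ _ (v (maxn N N'))); first by apply: NA; rewrite ?leq_maxl.
by apply: NA'; rewrite ?leq_maxr.
Qed.

Lemma boundary_classE a u : boundary_class a u ->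
  boundary_class a = [set v | gromov_seq v /\ gromov_equiv u v].
Proof.
move=> au; case: (boundary_classP a) (au) => w _ aE; rewrite aE => -[_ wu].
apply/seteqP; split=> v [vv ?]; split=> //.
  exact: gromov_equiv_trans (gromov_equiv_sym wu) _.
exact: gromov_equiv_trans wu _.
Qed.

Lemma boundary_class_gromov a u : boundary_class a u -> gromov_seq u.
Proof. by case: (boundary_classP a) => ? _ -> []. Qed.

Lemma boundary_eq a b u v : boundary_class a u -> boundary_class b v ->
  gromov_equiv u v -> a = b.
Proof.
move=> au bv uv; apply: boundary_inj.
rewrite (boundary_classE au) (boundary_classE bv).
apply/seteqP; split=> w [ww ?]; split=> //.
  exact: gromov_equiv_trans (gromov_equiv_sym uv) _.
exact: gromov_equiv_trans uv _.
Qed.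

Lemma boundary_class_bounded a u v (M : R) : boundary_class a u ->
  (forall n, mdist (u n) (v n) <= M) -> boundary_class a v.
Proof.
move=> au uvM.
have uu := boundary_class_gromov au; have /gromov_equivP uE := uu.
have uv : gromov_equiv u v.
  apply/gromov_equivP => o A; have [N NA] := uE o (A + M).
  exists N => i j Ni Nj; have := NA i j Ni Nj; have := uvM j.
  have := gromov_prod_lip o (u j) (v j) (u i).
  by rewrite !(gromov_prodC o (u i)); lra.
rewrite (boundary_classE au); split=> //.
exact: gromov_equiv_trans (gromov_equiv_sym uv) uv.
Qed.

(** If one pair of representatives had large products at arbitrarily late indices, two hyperbolicity
    steps would carry this to the tails of every other pair, forcing the boundary product to at
    least r + 1. *)
Lemma boundary_prod_le : exists2 k : R, 0 <= k & forall o a b (r : R),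
  ~ (r%:E < boundary_prod o a b)%E ->
  forall u v, boundary_class a u -> boundary_class b v ->
  exists N, forall i j, (N <= i)%N -> (N <= j)%N ->
    gromov_prod o (u i) (v j) <= r + k.
Proof.
have [d d0 hyp] := hyperbolicity; exists (1 + d + d); first by lra.
move=> o a b r nab u v au bv; apply: contrapT => nN; apply: nab.
apply: (@lt_le_trans _ _ (r + 1)%:E); first by rewrite lte_fin; lra.
apply: boundary_prod_ge => u' v' au' bv'.
have /gromov_equivP/(_ o (r + 1 + d))[N1 h1] := boundary_class_equiv au' au.
have /gromov_equivP/(_ o (r + 1 + d + d))[N2 h2] := boundary_class_equiv bv bv'.
apply/near_nat2P; exists (maxn N1 N2) => i j.
rewrite !geq_max => /andP[i1 _] /andP[_ j2].
apply: contrapT => /negP; rewrite -ltNge => /= ijr; apply: nN.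
exists (maxn N1 N2) => k l; rewrite !geq_max => /andP[k1 k2] /andP[l1 l2].
rewrite leNgt; apply/negP => kl.
suff : r + 1 <= gromov_prod o (u' i) (v' j) by lra.
apply: (hyp _ _ (u k)); first exact: h1.
apply: (hyp _ _ (v l)); last exact: h2.
by lra.
Qed.

Lemma boundary_prod_fin o a b : a <> b ->
  exists r : R, ~ (r%:E < boundary_prod o a b)%E.
Proof.
move=> nab; apply: contrapT => abr; apply: nab.
have [u au] := boundary_neq0 a; have [v bv] := boundary_neq0 b.
apply: (boundary_eq au bv); apply/gromov_equivP => o' A.
have /boundary_prod_gt/(_ au bv)/near_nat2P[N NA] :
    ((A + mdist o' o)%:E < boundary_prod o a b)%E.
  by apply: contrapT => nA; apply: abr; exists (A + mdist o' o).
exists N => i j Ni Nj; have /= := NA i j Ni Nj.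
by have := gromov_prod_base o' o (u i) (v j); lra.
Qed.

(** The bound E precedes the sequences and only N depends on them, so E also serves their translates
    by group elements. *)
Lemma boundary_neq_prod_le o a b : a <> b -> exists2 E : R, 0 <= E &
  forall u v, boundary_class a u -> boundary_class b v ->
  exists N, forall i j, (N <= i)%N -> (N <= j)%N ->
    gromov_prod o (u i) (v j) <= E.
Proof.
move=> /(boundary_prod_fin o)[r nr]; have [k _ kP] := boundary_prod_le.
exists (Num.max 0 (r + k)) => [|u v au bv]; first by rewrite le_max lexx.
have [N NE] := kP _ _ _ _ nr _ _ au bv; exists N => i j Ni Nj.
by rewrite le_max NE ?orbT.
Qed.

End Boundary.

Local Open Scope group_scope.
(** * Dynamics of a general type action *)

Section Action.
Context {G : groupType} {R : realType} {S : hyperbolicType R}.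
Variable rho : isometric_action G S.
Implicit Types (g h : G) (o s x y : S) (u v : nat -> S) (a b c : boundary S).

Lemma mdist_actV g o : mdist o (rho g^-1 o) = mdist o (rho g o).
Proof. by rewrite -(iact_isom rho g) iactVK metric_sym. Qed.

Lemma boundary_class_act g a u :
  boundary_class a u -> boundary_class (boundary_act rho g a) (rho g \o u).
Proof. by move=> au; exists u. Qed.

Lemma boundary_act1 a : boundary_act rho 1 a = a.
Proof.
have [u au] := boundary_neq0 a.
apply: (boundary_eq (boundary_class_act 1 au) au).
have -> : rho 1 \o u = u by apply/funext => n /=; rewrite iact1.
exact: boundary_class_gromov au.
Qed.

Lemma boundary_actM g h a :
  boundary_act rho (g * h) a = boundary_act rho g (boundary_act rho h a).
Proof.
have [u au] := boundary_neq0 a; have gh := boundary_class_act (g * h) au.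
apply: (boundary_eq gh (boundary_class_act g (boundary_class_act h au))).
have -> : rho g \o (rho h \o u) = rho (g * h) \o u.
  by apply/funext => n /=; rewrite iactM.
exact: boundary_class_gromov gh.
Qed.

Lemma limit_set_action1 (a : limit_set rho) : limit_set_action rho 1 a = a.
Proof. by apply: val_inj; exact: boundary_act1. Qed.

Lemma limit_set_actionM g h (a : limit_set rho) :
  limit_set_action rho (g * h) a =
  limit_set_action rho g (limit_set_action rho h a).
Proof. by apply: val_inj; exact: boundary_actM. Qed.

Lemma boundary_actK g : cancel (boundary_act rho g) (boundary_act rho g^-1).
Proof. by move=> a; rewrite -boundary_actM mulVg boundary_act1. Qed.

Lemma boundary_fixV g a : boundary_fix rho g a -> boundary_fix rho g^-1 a.
Proof. by rewrite /boundary_fix /= => {1}<-; rewrite boundary_actK. Qed.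

Lemma boundary_fix_cyclic g h a :
  cyclic_subgroup g h -> boundary_fix rho g a -> boundary_fix rho h a.
Proof.
move=> [n gh] ga; have gna : boundary_fix rho (g ^+ n) a.
  elim: n {gh} => [|n IHn]; first exact: boundary_act1.
  by rewrite /boundary_fix /= expgS boundary_actM IHn.
by case: gh => ->; [exact: gna|exact: boundary_fixV].
Qed.

(** As h^-1 u and h^-1 v still represent a and b, the product of u and v seen from h o is at most E.
    If h o were near neither sequence, both would have large product with o seen from h o, hence
    with each other. The constant is uniform in h. *)
Lemma fixing_pair_near o a b : a <> b -> exists2 E : R, (0 <= E)%R &
  forall h u v, boundary_fix rho h a -> boundary_fix rho h b ->
  boundary_class a u -> boundary_class b v ->
  exists N, forall i j, (N <= i)%N -> (N <= j)%N ->
    (mdist o (rho h o) - E <= gromov_prod o (rho h o) (u i) \/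
     mdist o (rho h o) - E <= gromov_prod o (rho h o) (v j))%R.
Proof.
move=> nab; have [E E0 EP] := boundary_neq_prod_le o nab.
have [d d0 hyp] := @hyperbolicity R S.
exists (E + d + d)%R => [|h u v ha hb au bv]; first by lra.
have au' : boundary_class a (rho h^-1 \o u).
  by have := boundary_class_act h^-1 au; rewrite (boundary_fixV ha).
have bv' : boundary_class b (rho h^-1 \o v).
  by have := boundary_class_act h^-1 bv; rewrite (boundary_fixV hb).
have [N NE] := EP _ _ au' bv'; exists N => i j Ni Nj.
have /= := NE i j Ni Nj.
rewrite -(gromov_prod_act rho h) !iactVK => uvE.
apply: contrapT => /not_orP[/negP + /negP]; rewrite -!ltNge => ui vj.
have hu := gromov_prodD o (rho h o) (u i).
have hv := gromov_prodD o (rho h o) (v j).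
suff : (E + d <= gromov_prod (rho h o) (u i) (v j))%R by lra.
apply: (hyp _ _ o); last by lra.
by rewrite gromov_prodC; lra.
Qed.

(** Otherwise h o is near a or b, h' o is near c or e, and the two orbit points are near each other.
    Chaining gives two representatives a product of at least M, which exceeds the bounds for all
    four pairs. *)
Lemma fixing_pairs_apart o a b c e :
  a <> b -> c <> e -> a <> c -> a <> e -> b <> c -> b <> e ->
  exists2 D : R, (0 <= D)%R & forall h h',
    boundary_fix rho h a -> boundary_fix rho h b ->
    boundary_fix rho h' c -> boundary_fix rho h' e ->
    (D <= mdist o (rho h o) -> D <= mdist o (rho h' o) ->
     gromov_prod o (rho h o) (rho h' o) <= D)%R.
Proof.
move=> /(fixing_pair_near o)[E1 E10 near1] /(fixing_pair_near o)[E2 E20 near2].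
move=> /(boundary_neq_prod_le o)[Eac Eac0 ac].
move=> /(boundary_neq_prod_le o)[Eae Eae0 ae].
move=> /(boundary_neq_prod_le o)[Ebc Ebc0 bc].
move=> /(boundary_neq_prod_le o)[Ebe Ebe0 be].
have [d d0 hyp] := @hyperbolicity R S.
pose M := (Eac + Eae + Ebc + Ebe + 1)%R.
exists (E1 + E2 + M + d + d)%R => [|h h' ha hb hc he Dh Dh'].
  by rewrite /M; lra.
have [u1 au1] := boundary_neq0 a; have [u2 bu2] := boundary_neq0 b.
have [v1 cv1] := boundary_neq0 c; have [v2 ev2] := boundary_neq0 e.
have [N1 h1] := near1 _ _ _ ha hb au1 bu2.
have [N2 h2] := near2 _ _ _ hc he cv1 ev2.
have [N3 h3] := ac _ _ au1 cv1; have [N4 h4] := ae _ _ au1 ev2.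
have [N5 h5] := bc _ _ bu2 cv1; have [N6 h6] := be _ _ bu2 ev2.
pose N := maxn N1 (maxn N2 (maxn N3 (maxn N4 (maxn N5 N6)))).
have chain x y : (M + d + d <= gromov_prod o (rho h o) x)%R ->
    (M + d + d <= gromov_prod o (rho h' o) y)%R ->
    (M + d + d < gromov_prod o (rho h o) (rho h' o))%R ->
    (M <= gromov_prod o x y)%R.
  move=> hx hy hh.
  apply: (hyp _ _ (rho h o)); first by rewrite gromov_prodC; lra.
  by apply: (hyp _ _ (rho h' o)); lra.
rewrite leNgt; apply/negP => Dhh.
have {h1} := h1 N N; have {h2} := h2 N N; have {h3} := h3 N N.
have {h4} := h4 N N; have {h5} := h5 N N; have {h6} := h6 N N.
rewrite !leq_max !leqnn ?orbT /= => h6 h5 h4 h3 h2 h1.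
have {}h6 := h6 isT isT; have {}h5 := h5 isT isT; have {}h4 := h4 isT isT.
have {}h3 := h3 isT isT.
have Mle x y : (mdist o (rho h o) - E1 <= gromov_prod o (rho h o) x)%R ->
    (mdist o (rho h' o) - E2 <= gromov_prod o (rho h' o) y)%R ->
    (M <= gromov_prod o x y)%R.
  by move=> hx hy; apply: chain; lra.
rewrite /M in Mle.
case: (h1 isT isT) => /Mle hx; case: (h2 isT isT) => /hx; lra.
Qed.

Lemma cyclic_far o p (M : R) : unbounded_orbits rho (cyclic_subgroup p) ->
  exists2 h, cyclic_subgroup p h & (M <= mdist o (rho h o))%R.
Proof.
move=> /(_ o) unb; apply: contrapT => nM; apply: unb.
exists (M + M)%R => _ _ [h ph <-] [h' ph' <-].
have far k : cyclic_subgroup p k -> (mdist o (rho k o) < M)%R.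
  by move=> pk; rewrite ltNge; apply/negP => Mk; apply: nM; exists k.
have := far _ ph; have := far _ ph'.
have := metric_triangle (rho h o) o (rho h' o).
by rewrite (metric_sym (rho h o) o); lra.
Qed.

(** If x is not near h^-1 o, then o and h x have small product seen from h o, so h x is near h o;
    and x is near h x. *)
Lemma displaced_near o h x (D d : R) :
  (forall (x y z o : S) (t : R),
    t + d <= gromov_prod o x z -> t + d <= gromov_prod o z y ->
    t <= gromov_prod o x y)%R ->
  (D + D + d <= mdist o (rho h o))%R ->
  (D + d <= gromov_prod o x (rho h x))%R ->
  (D <= gromov_prod o (rho h o) x)%R \/ (D <= gromov_prod o (rho h^-1%g o) x)%R.
Proof.
move=> hyp Dh xhx.
have [|nx] := leP D (gromov_prod o (rho h^-1 o) x); first by right.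
left; rewrite gromov_prodC; apply: (hyp _ _ (rho h x)) => //.
have := gromov_prodD o (rho h o) (rho h x).
have -> : gromov_prod (rho h o) o (rho h x) = gromov_prod o (rho h^-1 o) x.
  by rewrite -[RHS](gromov_prod_act rho h) iactVK.
by rewrite gromov_prodC; lra.
Qed.

Lemma general_type_mixing o : general_type rho -> exists C : R,
  forall x y, exists f,
    (mdist o (rho f o) <= C)%R /\ (gromov_prod o (rho f x) y <= C)%R.
Proof.
move=> [_ [p [q [[punb [a [b [/eqP ab pfix]]]] qlox pq0]]]].
have [qunb [c [e [/eqP ce qfix]]]] := qlox.
have pa : boundary_fix rho p a by rewrite pfix; left.
have pb : boundary_fix rho p b by rewrite pfix; right.
have qc : boundary_fix rho q c by rewrite qfix; left.
have qe : boundary_fix rho q e by rewrite qfix; right.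
have pqN (x y : boundary S) :
    boundary_fix rho p x -> boundary_fix rho q y -> x <> y.
  move=> px qy xy; have : (boundary_fix rho p `&` boundary_fix rho q) x.
    by split=> //; rewrite xy.
  by rewrite pq0.
have [D D0 apart] := fixing_pairs_apart o ab ce
  (pqN _ _ pa qc) (pqN _ _ pa qe) (pqN _ _ pb qc) (pqN _ _ pb qe).
have [d d0 hyp] := @hyperbolicity R S.
(* Two orbit points with product at least D1 with a common x have product at least D + 1, just
   beyond the bound D. *)
pose D1 := (D + d + 1)%R.
have [P pP farP] := cyclic_far o (D1 + D1 + d) punb.
have [Q qQ farQ] := cyclic_far o (D1 + D1 + d) qunb.
have Pab : boundary_fix rho P a /\ boundary_fix rho P b.
  by split; apply: boundary_fix_cyclic pP _.
have Qce : boundary_fix rho Q c /\ boundary_fix rho Q e.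
  by split; apply: boundary_fix_cyclic qQ _.
(* Only the displacements of P and Q enter, so this covers their inverses too. *)
have contra h h' x :
    boundary_fix rho h a /\ boundary_fix rho h b ->
    boundary_fix rho h' c /\ boundary_fix rho h' e ->
    mdist o (rho h o) = mdist o (rho P o) ->
    mdist o (rho h' o) = mdist o (rho Q o) ->
    (D1 <= gromov_prod o (rho h o) x)%R ->
    (D1 <= gromov_prod o (rho h' o) x)%R -> False.
  rewrite /D1 in farP farQ * => -[ha hb] [hc he] hP hQ hx hx'.
  have := apart _ _ ha hb hc he.
  have : (D + 1 <= gromov_prod o (rho h o) (rho h' o))%R.
    by apply: (hyp _ _ x); rewrite ?(gromov_prodC _ x); lra.
  rewrite hP hQ => ? app; have : (gromov_prod o (rho h o) (rho h' o) <= D)%R.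
    by apply: app; lra.
  by lra.
(* If x, P x and Q x were all near y, then x would be near both P x and Q x; this excludes that
   case. *)
have PQx x : (gromov_prod o x (rho P x) < D1 + d)%R \/
             (gromov_prod o x (rho Q x) < D1 + d)%R.
  apply: contrapT => /not_orP[/negP + /negP]; rewrite -!leNgt => xP xQ.
  have PVab : boundary_fix rho P^-1 a /\ boundary_fix rho P^-1 b.
    by case: Pab; split; exact: boundary_fixV.
  have QVce : boundary_fix rho Q^-1 c /\ boundary_fix rho Q^-1 e.
    by case: Qce; split; exact: boundary_fixV.
  case: (displaced_near hyp farP xP) => hx;
    case: (displaced_near hyp farQ xQ) => hx';
    by apply: contra hx hx'; rewrite ?mdist_actV.
exists (D1 + d + d + mdist o (rho P o) + mdist o (rho Q o))%R => x y.
have P0 := mdist_ge0 o (rho P o); have Q0 := mdist_ge0 o (rho Q o).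
apply: contrapT => nf.
have big f : (mdist o (rho f o) <= mdist o (rho P o) + mdist o (rho Q o))%R ->
    (D1 + d + d <= gromov_prod o (rho f x) y)%R.
  move=> fo; rewrite leNgt; apply/negP => fx; apply: nf; exists f.
  by rewrite /D1 in fx *; split; lra.
have big1 : (D1 + d + d <= gromov_prod o x y)%R.
  by have := big 1; rewrite !iact1; apply; rewrite mdistxx; lra.
have bigP : (D1 + d + d <= gromov_prod o (rho P x) y)%R by apply: big; lra.
have bigQ : (D1 + d + d <= gromov_prod o (rho Q x) y)%R by apply: big; lra.
have near f : (D1 + d + d <= gromov_prod o (rho f x) y)%R ->
    (D1 + d <= gromov_prod o x (rho f x))%R.
  by move=> fx; apply: (hyp _ _ y) => //; rewrite gromov_prodC.
by case: (PQx x); have := near _ bigP; have := near _ bigQ; lra.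
Qed.

(** * Proximality and small balls on the limit set *)

Lemma limit_set_orbit a o : limit_set rho a ->
  exists h : nat -> G, boundary_class a (fun n => rho (h n) o).
Proof.
move=> [s [h ah]]; exists h.
by apply: (boundary_class_bounded ah (M := mdist s o)) => n; rewrite iact_isom.
Qed.

Lemma limit_set_proximal a c o (r s : R) : general_type rho ->
  limit_set rho a -> limit_set rho c -> (0 <= r)%R -> (0 <= s)%R ->
  exists k, forall b, boundary_ball o a r b \/
                      boundary_ball o c s (boundary_act rho k b).
Proof.
move=> gt La Lc r0 s0; have [C mix] := general_type_mixing o gt.
have C0 : (0 <= C)%R.
  by have [f [fC _]] := mix o o; apply: le_trans fC; exact: mdist_ge0.
have [k0 k00 prodle] := @boundary_prod_le R S.
have [d d0 hyp] := @hyperbolicity R S.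
(* B is the product with k^-1 o that would force a point near a, after two losses of d. T absorbs
   the errors C and B and the three losses of d in the final chain, which must still give s + 1. *)
pose B := (r + k0 + 1 + d + d)%R; pose T := (C + C + B + B + s + d + d + d)%R.
have orbit_seq (z : boundary S) : limit_set rho z ->
    exists (h : nat -> G) (n : nat),
    boundary_class z (fun i => rho (h i) o) /\ forall i, (n <= i)%N ->
      (T <= gromov_prod o (rho (h i) o) (rho (h n) o))%R.
  move=> /(limit_set_orbit o)[h zh]; exists h.
  have /gromov_equivP/(_ o T)[n hn] := boundary_class_gromov zh.
  by exists n; split=> // i ni; exact: hn.
have [ha [n [aha nT]]] := orbit_seq _ La.
have [hc [m [chc mT]]] := orbit_seq _ Lc.
set g := ha n in nT; set h := hc m in mT.
have [f [foC fC]] := mix (rho g^-1 o) (rho h^-1 o).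
pose k := h * (f * g^-1).
have dg : (T <= mdist o (rho g o))%R.
  by have := nT n (leqnn _); rewrite gromov_prodxx metric_sym.
have dh : (T <= mdist o (rho h o))%R.
  by have := mT m (leqnn _); rewrite gromov_prodxx metric_sym.
have kh : (T - C <= gromov_prod o (rho h o) (rho k o))%R.
  have := gromov_prodD o (rho h o) (rho k o).
  have -> : gromov_prod (rho h o) o (rho k o) =
            gromov_prod o (rho f (rho g^-1 o)) (rho h^-1 o).
    by rewrite -[RHS](gromov_prod_act rho h) iactVK /k !iactM gromov_prodC.
  by lra.
have kg : (T - C - C <= gromov_prod o (rho g o) (rho k^-1%g o))%R.
  have := gromov_prodD o (rho g o) (rho k^-1 o).
  have -> : gromov_prod (rho g o) o (rho k^-1 o) =
            gromov_prod (rho f o) (rho f (rho g^-1 o)) (rho h^-1 o).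
    rewrite -[RHS](gromov_prod_act rho (g * f^-1)) -!iactM /k !invgM invgK.
    by rewrite mulgVK mulgV iact1.
  have := gromov_prod_base o (rho f o) (rho f (rho g^-1 o)) (rho h^-1 o).
  by lra.
exists k => b; have [|nab] := pselect (boundary_ball o a r b); [by left|right].
apply: (@lt_le_trans _ _ (s + 1)%:E); first by rewrite lte_fin; lra.
apply: boundary_prod_ge => u _ cu [v bv <-].
have [N1 aN] := prodle _ _ _ _ nab _ _ aha bv.
have /gromov_equivP/(_ o T)[N2 uN] := boundary_class_equiv cu chc.
apply/near_nat2P; exists (maxn N1 N2) => i j.
rewrite !geq_max => /andP[_ Ni] /andP[Nj _] /=.
(* Otherwise v j is near k^-1 o, hence near g o and the tail of the orbit sequence to a, against b
   lying outside the ball about a. *)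
have kv : (gromov_prod o (rho k^-1%g o) (v j) < B)%R.
  rewrite ltNge; apply/negP => Bv.
  pose l := maxn N1 n; have := aN l j (leq_maxl _ _) Nj.
  suff : (r + k0 + 1 <= gromov_prod o (rho (ha l) o) (v j))%R by lra.
  have gT := nT l (leq_maxr _ _).
  apply: (hyp _ _ (rho g o)); first by rewrite /T /B in gT; lra.
  by apply: (hyp _ _ (rho k^-1 o)); rewrite /T /B in kg Bv; lra.
have kkv : (T - C - B <= gromov_prod o (rho k o) (rho k (v j)))%R.
  have := gromov_prodD o (rho k o) (rho k (v j)).
  have -> : gromov_prod (rho k o) o (rho k (v j)) =
            gromov_prod o (rho k^-1 o) (v j).
    by rewrite -[RHS](gromov_prod_act rho k) iactVK.
  have := gromov_prod_le_mdist o (rho k o) (rho h o).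
  by rewrite gromov_prodC (metric_sym (rho k o)); lra.
pose l := maxn N2 m.
(* The chain runs from u i through [hc l] o, h o and k o to k (v j). *)
have ul := uN i l Ni (leq_maxl _ _); have lh := mT l (leq_maxr _ _).
apply: (hyp _ _ (rho (hc l) o)); first by rewrite /T /B in ul; lra.
apply: (hyp _ _ (rho h o)); first by rewrite /T /B in lh; lra.
by apply: (hyp _ _ (rho k o)); rewrite /T /B in kh kkv; lra.
Qed.

(** If b and g b were both near c, then g b would be near both c and g c, against the bound E for
    these distinct points. The displacement of o in the radius pays for moving the base point from g
    o back to o. *)
Lemma boundary_ball_moved o c g : boundary_act rho g c <> c ->
  exists2 r : R, (0 <= r)%R & forall b, boundary_ball o c r b ->
    ~ boundary_ball o c r (boundary_act rho g b).
Proof.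
move=> /nesym /(boundary_neq_prod_le o)[E E0 EP].
have [d d0 hyp] := @hyperbolicity R S.
have go0 := mdist_ge0 o (rho g o).
exists (E + mdist o (rho g o) + d + 1)%R => [|b cb cgb]; first by lra.
have [u cu] := boundary_neq0 c; have [v bv] := boundary_neq0 b.
have gbv := boundary_class_act g bv.
have /near_nat2P[N1 h1] := boundary_prod_gt cb cu bv.
have /near_nat2P[N2 h2] := boundary_prod_gt cgb cu gbv.
have [N3 h3] := EP _ _ cu (boundary_class_act g cu).
pose N := maxn N1 (maxn N2 N3).
have {h1} := h1 N N; have {h2} := h2 N N; have {h3} := h3 N N.
rewrite !leq_max !leqnn ?orbT /= => h3 h2 h1.
have {}h1 := h1 isT isT; have {}h2 := h2 isT isT; have {}h3 := h3 isT isT.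
suff : (E + 1 <= gromov_prod o (u N) (rho g (u N)))%R by lra.
apply: (hyp _ _ (rho g (v N))); first by lra.
have := gromov_prod_base o (rho g o) (rho g (u N)) (rho g (v N)).
by rewrite gromov_prod_act (gromov_prodC o (rho g (v N))); lra.
Qed.

(** Open sets of the limit set are traces of open sets of the boundary, where the balls at a single
    base point already form a neighbourhood base. *)
Lemma limit_set_interior_ball o (F : set (limit_set rho)) (a : limit_set rho) :
  F° a -> exists2 r : R, (0 <= r)%R &
    forall b : limit_set rho, boundary_ball o (val a) r (val b) -> F b.
Proof.
move=> [_ [[V openV <-] Va] VF].
have : nbhs (val a) V by apply: open_nbhs_nbhs.
rewrite (nbhs_boundaryE o) => -[r /= r0 rV].
by exists r => // b /rV; exact: VF.
Qed.

End Action.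
Theorem corollary2p36 (R : realType) (G : groupType)
    (hfwh : faithful_weakly_hyperbolic R G) (hnlf : ~ lim_free R G) :
  exists (I : Type) (H : I -> set G),
    [/\ infinite_set [set: I],
        forall i, [/\ is_subgroup (H i), infinite_set (H i) & ~ abelian_set (H i)]
      & generate_direct_sum H].
Proof.
have [S [rho [gt faith]]] := hfwh.
have [g g1 [a Fa]] : exists2 g : G, g <> 1 &
    [set x | limit_set_action rho g x = x]° !=set0.
  apply: contrapT => nfree; apply: hnlf; exists S, rho; split=> // g /eqP g1.
  by apply: contrapT => /eqP/set0P ne; apply: nfree; exists g.
have [c gc] : exists c, limit_set_action rho g c <> c.
  apply: contrapT => nc; apply/g1/faith => x.
  by apply: contrapT => gx; apply: nc; exists x.
(* A base point is read off from a sequence representing a. *)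
have [u _] := boundary_neq0 (val a); set o := u 0%N.
have [r r0 ballF] := limit_set_interior_ball o Fa.
have [s s0 moved] : exists2 s : R, (0 <= s)%R & forall b,
    boundary_ball o (val c) s b ->
    ~ boundary_ball o (val c) s (boundary_act rho g b).
  by apply: boundary_ball_moved => gcc; apply: gc; exact: val_inj.
have [k kP] := limit_set_proximal o gt
  (set_mem (valP a)) (set_mem (valP c)) r0 s0.
(* Here A is the complement of a ball about a on which g is trivial, and W is a ball about c that g
   moves off itself. *)
apply: (@contraction_direct_sum G (limit_set rho) (limit_set_action rho)
  (@limit_set_action1 _ _ _ rho) (@limit_set_actionM _ _ _ rho) faith
  [set b | ~ boundary_ball o (val a) r (val b)]
  [set b | boundary_ball o (val c) s (val b)] g k) => //.
- by move=> b /= /contrapT /ballF.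
- by move=> b /=; exact: moved.
- by move=> b /= nb; case: (kP (val b)).
Qed.
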